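(* Fix an integer $d\ge2$. Let $\widetilde p_k(n)$ be the proportion of vertices of degree $k$ in $\mathrm{RAN}_d(n)$. There exist a probability distribution $\{p_k\}_{k=d+1}^\infty$ and a constant $c$ such that, as $n\to\infty$, $$\mathbb P\Big(\max_k\big|\widetilde p_k(n)-p_k\big|\ge c\sqrt{\tfrac{\log n}{n}}\Big)=o(1).$$ Further, $p_k$ follows a power law with exponent $\frac{2d-1}{d-1}\in(2,3]$; more precisely, for $k\ge d+1$, $$p_k=\frac{d}{2d+1}\,\frac{\Gamma\big(k-d+\frac{2}{d-1}\big)}{\Gamma\big(1+\frac{2}{d-1}\big)}\,\frac{\Gamma\big(2+\frac{d+2}{d-1}\big)}{\Gamma\big(k+1-d+\frac{d+2}{d-1}\big)}=C\,k^{-\frac{2d-1}{d-1}}(1+o(1))\quad(k\to\infty)$$ for some constant $C=C(d)>0$, where $\Gamma$ is the Gamma function.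
   Context: Random Apollonian network $\mathrm{RAN}_d(n)$: at step $0$, take a $d$-dimensional simplex ($d+1$ mutually adjacent vertices) with one additional interior vertex joined to all $d+1$ vertices of the simplex (so the graph is the complete graph on $d+2$ vertices). The $d+1$ sets consisting of the interior vertex and $d$ of the simplex vertices are the initial active cliques. At each step $n\ge1$, pick an active clique $C_n$ of $\mathrm{RAN}_d(n-1)$ uniformly at random, insert a new vertex $v_n$ joined to all $d+1$ vertices of $C_n$; $C_n$ becomes inactive, and the $d+1$ cliques formed by $v_n$ with each choice of $d$ vertices of $C_n$ become active. The result is $\mathrm{RAN}_d(n)$, which has $n+d+2$ vertices. $\widetilde p_k(n):=\frac{1}{n+d+2}\sum_{i=1}^{n+d+2}\mathbf 1\{D_i(n)=k\}$, where $D_i(n)$ is the degree of vertex $i$ in $\mathrm{RAN}_d(n)$. *)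

(* Defs.v *)
From HB Require Import structures.
From mathcomp Require Import all_boot all_order all_algebra.
From mathcomp Require Import finmap.
From mathcomp Require Import all_classical all_reals all_analysis.
Import Order.TTheory GRing.Theory Num.Theory.
Import numFieldNormedType.Exports.
Set Implicit Arguments.
Unset Strict Implicit.
Unset Printing Implicit Defensive.

Local Open Scope classical_set_scope.
Local Open Scope ring_scope.

(* Euler's integral; meant for x > 0, where it converges. *)
Definition Gamma (R : realType) (x : R) : R :=
  \int[@lebesgue_measure R]_(t in `]0, +oo[%classic) (t `^ (x - 1) * expR (- t)).

(* Vertices are numbered in order of arrival: 0, ..., d are the vertices of the
   initial simplex, d+1 is its interior vertex, and v_n is the number n+d+1.
   Edges are given by the adjacency relation. *)
Record network := Network {
  adj : rel nat;
  active : {fset {fset nat}} }.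

(* The sets made of v and of all but one of the elements of K. *)
Definition subcliques (v : nat) (K : {fset nat}) : {fset {fset nat}} :=
  [fset v |` (K `\ x) | x in K]%fset.

Definition simplex (d : nat) : {fset nat} := [fset i | i in iota 0 d.+1]%fset.

Definition ran_init (d : nat) : network :=
  Network (fun i j => [&& (i < d.+2)%N, (j < d.+2)%N & i != j])
          (subcliques d.+1 (simplex d)).

Definition ran_insert (v : nat) (K : {fset nat}) (G : network) : network :=
  Network
    (fun i j => [|| adj G i j, (i == v) && (j \in K) | (j == v) && (i \in K)])
    ((active G `\ K) `|` subcliques v K)%fset.

Definition ran_order (d n : nat) : nat := (n + d + 2)%N.

(* RAN_d(n) as a function of the cliques chosen so far; c m is the choice made
   at step m+1, when the vertex numbered ran_order d m is inserted. *)
Fixpoint ran (d : nat) (c : nat -> {fset nat}) (n : nat) : network :=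
  if n is m.+1 then ran_insert (ran_order d m) (c m) (ran d c m)
  else ran_init d.

(* The random cliques C 0, C 1, ... drive a random Apollonian network: given
   the choices made in the first n steps, the next one is uniformly distributed
   on the active cliques of the current network.  The conditioning is on a
   discrete history and is written multiplicatively. *)
Definition ran_process (R : realType) (disp : measure_display)
    (T : measurableType disp) (P : probability T R) (d : nat)
    (C : nat -> T -> {fset nat}) : Prop :=
  (forall n K, measurable [set w | C n w = K]) /\
  (forall n (c : nat -> {fset nat}) K,
    P [set w | (forall m, (m < n)%N -> C m w = c m) /\ C n w = K] =
    (((K \in active (ran d c n))%:R / #|` active (ran d c n)|%:R : R)%:E *
     P [set w | forall m, (m < n)%N -> C m w = c m])%E).

Definition degree (d n : nat) (G : network) (i : nat) : nat :=
  #|[set j : 'I_(ran_order d n) | adj G i j]%SET|.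

Definition degree_proportion (R : realType) (d n : nat) (G : network)
    (k : nat) : R :=
  #|[set i : 'I_(ran_order d n) | degree d n G i == k]%SET|%:R
    / (ran_order d n)%:R.

Definition probability_distribution_from (R : realType) (m : nat)
    (p : nat -> R) : Prop :=
  [/\ forall k, 0 <= p k,
      forall k, (k < m)%N -> p k = 0
    & (\sum_(0 <= k <oo) (p k)%:E = 1)%E].

(* Main.v *)
(** A vertex of degree d + 1 + l lies in w_l = d + 1 + l (d - 1) of the
    A_n = d + 1 + d n active cliques, so that the expected number of such
    vertices solves a linear recursion with exact solution (A_n / d) q_l, where
    q_l (d + w_l) = q_(l-1) w_(l-1); this is the Gamma quotient.  The deviations
    X_l of the numbers of vertices from (A_n / d) q_l have a drift
    (w_(l-1) X_(l-1) - w_l X_l) / A_n which, as w is nondecreasing, cannot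
    increase the sum of the X_l ^ 2, while the noise of one insertion adds at
    most (2 d + 4) ^ 2 to it in the mean.  So the mean of the sum of the
    X_l ^ 2 is O(n), and Markov's inequality gives the concentration, uniformly
    in the degree, without any martingale inequality.  All histories of the
    process being equally likely, means are averages over a finite list.

    For the power law, with tau = (2 d - 1) / (d - 1) and
    y_l = l + 1 + 2 / (d - 1), Bernoulli's inequality makes q_l y_l ^ tau
    nondecreasing and q_l (y_l + tau - 1) ^ tau nonincreasing. *)

Require Import Defs.
From HB Require Import structures.
From mathcomp Require Import all_boot all_order all_algebra.
From mathcomp Require Import finmap.
From mathcomp Require Import all_classical all_reals all_analysis.
From mathcomp Require Import measurable_realfun ring lra zify.
Import Order.TTheory GRing.Theory Num.Theory.
Import numFieldNormedType.Exports.
Set Implicit Arguments.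
Unset Strict Implicit.
Unset Printing Implicit Defensive.

Local Open Scope classical_set_scope.
Local Open Scope ring_scope.

(** * The Gamma function on [x > 1]: functional equation and positivity *)

Lemma expR_div2 (R : realType) (t : R) :
  expR (- t) * expR (t / 2) = expR (- (t / 2)).
Proof. by rewrite -expRD; congr expR; lra. Qed.

Lemma cvg_expR_half (R : realType) :
  expR (- (t / 2)) @[t --> +oo] --> (0 : R).
Proof.
apply: (@cvg_comp _ _ _ (fun t : R => t / 2) (fun t : R => expR (- t)) _
  (pinfty_nbhs R)); last exact: cvgr_expR.
exact: gt0_cvgMly.
Qed.

Section Gamma_function.
Variables (R : realType) (x : R).
Hypothesis x_gt1 : 1 < x.
Let x_gt0 : 0 < x. Proof. exact: lt_trans x_gt1. Qed.
Let x_neq0 : x != 0. Proof. by rewrite gt_eqF. Qed.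
Let x1_gt0 : 0 < x - 1. Proof. by rewrite subr_gt0. Qed.

Let mu := @lebesgue_measure R.
Let K : R := (2 * x) `^ x.
Let b (t : R) := t `^ x * expR (- t).
Let g (t : R) := K * expR (- (t / 2)).
Let a (t : R) := t `^ (x - 1) * expR (- t).
(* The half-line fundamental theorem of calculus needs a nonnegative integrand:
   f, the derivative of b - 2 g, is b' made nonnegative by adding g. *)
Let f (t : R) := x * a t + (g t - b t).

(** The inequality [s <= expR s] at [s = t / (2 * x)], raised to the power [x], bounds [t ^ x] by
    [K * exp (t / 2)]; [K] is chosen for this. *)
Let b_le_g (t : R) : 0 <= t -> b t <= g t.
Proof.
move=> t0; rewrite /b /g -expR_div2 mulrCA [leLHS]mulrC.
rewrite ler_wpM2l ?expR_ge0//.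
pose s := t / (2 * x).
have s0 : 0 <= s by rewrite mulr_ge0// invr_ge0 mulr_ge0// ltW.
have -> : t = 2 * x * s by rewrite mulrC divfK// mulf_neq0.
rewrite powRM ?(mulr_ge0, invr_ge0, ltW x_gt0)// /K ler_wpM2l ?powR_ge0//.
have -> : 2 * x * s / 2 = s * x by field.
rewrite expRM; apply: ge0_ler_powR; rewrite ?nnegrE ?expR_ge0 ?(ltW x_gt0)//.
by apply: le_trans (expR_ge1Dx _); rewrite lerDr.
Qed.

Let powR_cvg_at0 (y : R) : 0 < y -> t `^ y @[t --> 0^'+] --> 0 `^ y.
Proof. by move=> y0; rewrite powR0 ?gt_eqF//; exact: powR_cvg0. Qed.

Let continuous_expN : continuous (fun t : R => expR (- t)).
Proof.
move=> t; apply: continuous_comp; last exact: continuous_expR.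
exact: (@continuousN _ R^o).
Qed.

Let continuous_exp_half : continuous (fun t : R => expR (- (t / 2))).
Proof.
move=> t; apply: continuous_comp; last exact: continuous_expR.
by apply: (@continuousN _ R^o); apply: mulrr_continuous.
Qed.

Let continuous_powR (y t : R) : 0 < t -> {for t, continuous (fun s : R => s `^ y)}.
Proof.
move=> t0; have [+ _] := is_derive1_powR y t0.
by move=> /derivable1_diffP/differentiable_continuous.
Qed.

Let F t := b t - 2 * g t.

Let cvg_g : g t @[t --> +oo] --> (0 : R).
Proof.
by rewrite -(mulr0 K); apply: cvgM; [exact: cvg_cst|exact: cvg_expR_half].
Qed.

Let cvg_b : b t @[t --> +oo] --> (0 : R).
Proof.
apply: (@squeeze_cvgr _ _ _ _ (fun=> 0) g) cvg_g; last exact: cvg_cst.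
by near=> t; rewrite b_le_g ?andbT ?mulr_ge0 ?powR_ge0 ?expR_ge0.
Unshelve. all: end_near. Qed.

Let f_ge0 (t : R) : 0 <= t -> 0 <= f t.
Proof.
move=> t0; rewrite /f addr_ge0 ?subr_ge0 ?b_le_g//.
by rewrite !mulr_ge0 ?powR_ge0 ?expR_ge0// ltW.
Qed.

Let cont_f : {within `[0, +oo[, continuous f}.
Proof.
apply/continuous_within_itvcyP; split.
  move=> t; rewrite in_itv/= andbT => t0.
  have ce := @continuous_expN t.
  apply: cvgD; [apply: cvgM; first exact: cvg_cst|apply: cvgB].
  - by apply: cvgM => //; exact: continuous_powR.
  - by apply: cvgM; [exact: cvg_cst|exact: continuous_exp_half].
  - by apply: cvgM => //; exact: continuous_powR.
have ce : expR (- t) @[t --> 0^'+] --> expR (- 0 : R).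
  by apply/cvg_at_right_filter; exact: continuous_expN.
apply: cvgD; [apply: cvgM; first exact: cvg_cst|apply: cvgB].
- by apply: cvgM => //; exact: powR_cvg_at0.
- apply: cvgM; first exact: cvg_cst.
  by apply/cvg_at_right_filter; exact: continuous_exp_half.
- by apply: cvgM => //; exact: powR_cvg_at0.
Qed.

Let is_derive_F (t : R) : 0 < t -> is_derive t 1 F (f t).
Proof.
move=> t0.
have d1 := is_derive1_powR x t0.
have d2 : is_derive t 1 (fun u : R => expR (- u)) (- expR (- t)).
  by apply: is_derive_eq; rewrite /GRing.scale/=; ring.
have d3 : is_derive t 1 (fun u : R => expR (- (u / 2))) (- (expR (- (t / 2)) / 2)).
  apply: is_derive_eq; rewrite /GRing.scale/=; lra.
rewrite /F /b /g.
have -> : f t = (t `^ x *: - expR (- t) + expR (- t) *: (x * t `^ (x - 1)))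
   - 2 *: (K *: (- (expR (- (t / 2)) / 2))).
  by rewrite /f /a /b /g /GRing.scale/=; field.
by apply: is_deriveB; exact: is_deriveM.
Qed.

(** [F] tends to 0 at infinity and to [- 2 K] at 0, where [t ^ x] vanishes. *)
Let integral_f :
  (\int[mu]_(t in `[0%R, +oo[) (f t)%:E = (2 * K)%:E)%E.
Proof.
rewrite (@ge0_continuous_FTC2y _ f F 0 0) //.
- rewrite /F /b /g powR0// !mul0r oppr0 expR0; congr EFin; lra.
- rewrite -[X in _ --> X](_ : 0 - 2 * 0 = 0); last by rewrite mulr0 subr0.
  by apply: cvgB => //; apply: cvgM => //; exact: cvg_cst.
- by move=> t t0; have [] := is_derive_F t0.
- apply: cvgB.
    apply: cvgM; first exact: powR_cvg_at0.
    by apply/cvg_at_right_filter; exact: continuous_expN.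
  apply: cvgM; first exact: cvg_cst.
  apply: cvgM; first exact: cvg_cst.
  by apply/cvg_at_right_filter; exact: continuous_exp_half.
- move=> t; rewrite in_itv/= andbT => t0.
  by rewrite derive1E; have [_ ->] := is_derive_F t0.
Qed.

Let g_ge0 t : 0 <= g t. Proof. by rewrite mulr_ge0 ?powR_ge0 ?expR_ge0. Qed.

Let integral_g :
  (\int[mu]_(t in `[0%R, +oo[) (g t)%:E = (2 * K)%:E)%E.
Proof.
have cg : continuous g.
  by move=> t; apply: cvgM; [exact: cvg_cst|exact: continuous_exp_half].
have dG (t : R) : is_derive t 1 (fun u => - (2 * g u)) (g t).
  have d3 : is_derive t 1 (fun u : R => expR (- (u / 2))) (- (expR (- (t / 2)) / 2)).
    apply: is_derive_eq; rewrite /GRing.scale/=; lra.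
  by apply: is_derive_eq; rewrite /g /GRing.scale/=; field.
rewrite (@ge0_continuous_FTC2y _ g (fun u => - (2 * g u)) 0 0) //.
- by rewrite /g mul0r oppr0 expR0; congr EFin; lra.
- exact: continuous_subspaceT.
- rewrite -oppr0; apply: cvgN; rewrite -(mulr0 2); apply: cvgM => //.
  exact: cvg_cst.
- apply: cvgN; apply: cvgM; first exact: cvg_cst.
  by apply/cvg_at_right_filter; exact: cg.
- by move=> t _; rewrite derive1E; have [_ ->] := dG t.
Qed.

Let mexpN : measurable_fun [set: R] (fun t : R => expR (- t)).
Proof. exact: continuous_measurable_fun. Qed.

Let ma D : measurable_fun D a.
Proof.
apply: (measurable_funS measurableT) => //.
by apply: measurable_funM => //; exact: measurable_powR.
Qed.

Let mb D : measurable_fun D b.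
Proof.
apply: (measurable_funS measurableT) => //.
by apply: measurable_funM => //; exact: measurable_powR.
Qed.

Let mg D : measurable_fun D g.
Proof.
apply: (measurable_funS measurableT) => //.
by apply: measurable_funM => //; exact: continuous_measurable_fun.
Qed.

Let mf D : measurable_fun D f.
Proof.
apply: measurable_funD; first by apply: measurable_funM.
exact: measurable_funB.
Qed.

Let a_ge0 t : 0 <= a t. Proof. by rewrite mulr_ge0 ?powR_ge0 ?expR_ge0. Qed.
Let b_ge0 t : 0 <= b t. Proof. by rewrite mulr_ge0 ?powR_ge0 ?expR_ge0. Qed.

Let D0 : set R := `]0, +oo[%classic.

Let mD0 : measurable D0. Proof. exact: measurable_itv. Qed.

Let mE (h : R -> R) D : (forall A, measurable_fun A h) ->
  measurable_fun D (fun t => (h t)%:E).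
Proof. by move=> mh; apply/measurable_EFinP. Qed.

Let geE (h : R -> R) t : (forall s, 0 <= h s) -> D0 t -> (0 <= (h t)%:E)%E.
Proof. by move=> h0 _; rewrite lee_fin. Qed.

Let integral_b_fin : (\int[mu]_(t in D0) (b t)%:E <= (2 * K)%:E)%E.
Proof.
rewrite -integral_g -integral_itv_obnd_cbnd; last exact: mE.
apply: ge0_le_integral; [exact: mD0|by move=> t; exact: geE|exact: mE|exact: mE|].
by move=> t; rewrite /D0/= in_itv/= andbT => /ltW t0; rewrite lee_fin b_le_g.
Qed.

(** Integration by parts without subtracting integrals: [x a + g = f + b], all four terms are
    nonnegative on the half-line, and [f] and [g] have the same finite integral [2 K], which
    cancels. *)
Let integral_ab :
  (\int[mu]_(t in D0) (b t)%:E = x%:E * \int[mu]_(t in D0) (a t)%:E)%E.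
Proof.
have xa_ge0 t : 0 <= x * a t by rewrite mulr_ge0// ltW.
have mxa A : measurable_fun A (fun t => x * a t) by exact: measurable_funM.
have : (\int[mu]_(t in D0) ((x * a t)%:E + (g t)%:E) =
        \int[mu]_(t in D0) ((f t)%:E + (b t)%:E))%E.
  by apply: eq_integral => t _; rewrite -!EFinD; congr EFin; rewrite /f; lra.
pose xa t := x * a t.
rewrite ge0_integralD; [|exact: mD0|by move=> t; exact: (@geE xa)|exact: (@mE xa)
  |by move=> t; exact: geE|exact: mE].
rewrite ge0_integralD; [|exact: mD0| |exact: mE|by move=> t; exact: geE|exact: mE]; last first.
  by move=> t; rewrite /D0/= in_itv/= andbT => /ltW t0; rewrite lee_fin f_ge0.
rewrite [X in (_ + X)%E = _]integral_itv_obnd_cbnd; last exact: mE.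
rewrite [X in (_ = X + _)%E]integral_itv_obnd_cbnd; last exact: mE.
rewrite integral_f integral_g [RHS]addeC => /(congr1 (fun y => y - (2 * K)%:E))%E.
rewrite !addeK// => <-.
under eq_integral do rewrite EFinM.
rewrite ge0_integralZl_EFin; [by []|exact: mD0|by move=> t; exact: geE|exact: mE|exact: ltW].
Qed.

(** After [integral_ab] only finiteness remains, to pass to real values: an infinite integral of [a]
    would make that of [b] infinite, against [b <= g]. The assumption [1 < x] makes the integrand of
    [Gamma x] continuous at 0; every argument met below satisfies it. *)
Lemma GammaS : Gamma (x + 1) = x * Gamma x.
Proof.
rewrite /Gamma addrK /Rintegral -/mu -/D0 integral_ab.
have : (\int[mu]_(t in D0) (a t)%:E)%E \is a fin_num.
  rewrite ge0_fin_numE; last by apply: integral_ge0 => t _; rewrite lee_fin.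
  rewrite ltNge leye_eq; apply/negP => /eqP E.
  have := integral_b_fin.
  by rewrite integral_ab E gt0_muley ?lte_fin// leye_eq.
by move=> fa; rewrite fineM.
Qed.

(** On [[1, 2]] the integrand is at least [exp (- 2)]. Finiteness matters too, since [fine] sends
    infinity to 0. *)
Lemma Gamma_succ_gt0 : 0 < Gamma (x + 1).
Proof.
rewrite /Gamma addrK /Rintegral -/mu -/D0; apply: fine_gt0.
apply/andP; split; last by apply: le_lt_trans integral_b_fin _; rewrite ltry.
have sub : `[1%R, 2%R] `<=` D0.
  by move=> t; rewrite /D0/= !in_itv/= andbT => /andP[t1 _]; apply: lt_le_trans t1.
apply: (@lt_le_trans _ _ (\int[mu]_(t in `[1%R, 2%R]) (b t)%:E)%E); last first.
  apply: ge0_subset_integral => //; first exact: mE.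
  by move=> t; exact: geE.
apply: (@lt_le_trans _ _ (\int[mu]_(t in `[1%R, 2%R]) (cst (expR (- 2))%:E t))%E).
  rewrite integral_cst//= /mu lebesgue_measure_itv/= lte_fin ltr1n.
  by rewrite -EFinB -EFinM lte_fin mulr_gt0 ?expR_gt0//; lra.
apply: ge0_le_integral; [exact: measurable_itv| |exact: measurable_cst|exact: mE|].
  by move=> t _; rewrite lee_fin expR_ge0.
move=> t; rewrite /= in_itv/= => /andP[t1 t2]; rewrite lee_fin.
rewrite -[leLHS]mul1r; apply: ler_pM; rewrite ?expR_ge0//.
  by rewrite -(powRr0 t); apply: ler_powR => //; exact: ltW.
by rewrite ler_expR lerN2.
Qed.

Lemma Gamma_gt0 : 0 < Gamma x.
Proof. by rewrite -(pmulr_rgt0 _ x_gt0) -GammaS Gamma_succ_gt0. Qed.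

End Gamma_function.

(** * The limiting proportions: recursion, total mass, Gamma quotient, power law *)

Definition ran_weight (d l : nat) : nat := (d.+1 + l * d.-1)%N.

(* The limiting proportion of vertices of degree d + 1 + l. *)
Fixpoint limit_proportion (R : realType) (d l : nat) : R :=
  if l is m.+1 then
    (ran_weight d m)%:R * limit_proportion R d m / (d + ran_weight d l)%:R
  else d%:R / (2 * d%:R + 1).

(** Bernoulli's inequality for a real exponent. Let [u] be the left side; when [u > 0], the bound
    [ln z <= z - 1] is used at [u / m] and, with weight [t - 1], at [1 / m]. The right sides add up
    to 0, so [ln u <= t * ln m]. *)
Lemma bernoulli_powR (R : realType) (t m : R) : 1 <= t -> 0 < m ->
  1 + t * (m - 1) <= m `^ t.
Proof.
move=> t1 m0; have [u0|u0] := leP (1 + t * (m - 1)) 0.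
  by apply: le_trans u0 _; exact: powR_ge0.
have ln_le z : 0 < z -> ln z <= z - 1 :> R.
  by move=> z0; have := @le_ln1Dx R (z - 1); rewrite subrKC; apply; lra.
set u := 1 + _ in u0 *.
rewrite -[leLHS]lnK ?posrE// /powR gt_eqF// ler_expR.
have h1 := ln_le (u / m) (divr_gt0 u0 m0).
have h2 : (t - 1) * ln m^-1 <= (t - 1) * (m^-1 - 1).
  by rewrite ler_wpM2l ?ln_le ?invr_gt0//; lra.
move: h1 h2; rewrite ln_div ?posrE// lnV ?posrE// => h1 h2.
have : u / m - 1 + (t - 1) * (m^-1 - 1) = 0 by rewrite /u; field; rewrite gt_eqF.
lra.
Qed.

Section limit_proportion.
Variables (R : realType) (d : nat).
Hypothesis d_ge2 : (2 <= d)%N.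
Local Notation D := (d%:R : R).
Local Notation q := (limit_proportion R d).
Local Notation w l := ((ran_weight d l)%:R : R).

Let D_ge2 : 2 <= D. Proof. by rewrite ler_nat. Qed.

Lemma ran_weightE l : w l = D + 1 + l%:R * (D - 1).
Proof. by rewrite /ran_weight natrD natrM -addn1 natrD -subn1 natrB// ltnW. Qed.

Lemma limit_proportion_gt0 l : 0 < q l.
Proof.
have D2 := D_ge2; elim: l => [|l IH] /=; first by apply: divr_gt0; lra.
by rewrite divr_gt0 ?mulr_gt0// ?ltr0n ?addn_gt0 ?orbT.
Qed.

Lemma limit_proportionS l :
  w l * q l = (D + w l.+1) * q l.+1.
Proof.
rewrite /= -natrD [RHS]mulrC divfK// pnatr_eq0 -lt0n addn_gt0.
by rewrite (ltn_trans _ d_ge2).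
Qed.

Lemma limit_proportion0 : D = (D + w 0) * q 0.
Proof. by have := D_ge2; rewrite ran_weightE /= mul0r => D2; field; lra. Qed.

(** The ratio of consecutive terms is at most [(l + 3) / (l + 5)], so [q l * (l + 3) * (l + 4)] is
    nonincreasing; at [l = 0] it is [12 * q 0 <= 12]. This quadratic decay makes [w l * q l] vanish
    in the limit and later controls the levels too high to be occupied. *)
Lemma limit_proportion_le l : q l <= 12 / ((l%:R + 3) * (l%:R + 4)).
Proof.
have D2 := D_ge2.
elim: l => [|l IH].
  have -> : 12 / ((0%:R + 3) * (0%:R + 4)) = 1 :> R by field.
  by rewrite /= ler_pdivrMr; lra.
have l0 : 0 <= l%:R :> R by rewrite ler0n.
have q0 := limit_proportion_gt0 l; have q1 := limit_proportion_gt0 l.+1.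
have := limit_proportionS l; rewrite !ran_weightE -natr1 => E.
rewrite ler_pdivlMr; last by apply: mulr_gt0; lra.
move: IH; rewrite ler_pdivlMr; last by apply: mulr_gt0; lra.
apply: le_trans.
set x := l%:R in l0 E *.
have h' : (x + 5) * q l.+1 <= (x + 3) * q l.
  pose W := D + (D + 1 + (x + 1) * (D - 1)).
  have W0 : 0 < W by rewrite /W; nra.
  rewrite -(ler_pM2l W0) [leLHS]mulrCA -E -subr_ge0.
  have -> : W * ((x + 3) * q l) - (x + 5) * ((D + 1 + x * (D - 1)) * q l)
    = (x + 4 * D - 5) * q l by rewrite /W; ring.
  by apply: mulr_ge0; lra.
have -> : q l.+1 * ((x + 1 + 3) * (x + 1 + 4)) = (x + 4) * ((x + 5) * q l.+1) by ring.
have -> : q l * ((x + 3) * (x + 4)) = (x + 4) * ((x + 3) * q l) by ring.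
by rewrite ler_pM2l//; lra.
Qed.

(** Telescoping: the recursion reads [D q_(l+1) = w_l q_l - w_(l+1) q_(l+1)]. *)
Lemma sum_limit_proportion n :
  D * \sum_(l < n.+1) q l = D - w n * q n.
Proof.
elim: n => [|n IH].
  rewrite big_ord1; have := limit_proportion0; lra.
rewrite big_ord_recr mulrDr IH limit_proportionS; lra.
Qed.

Lemma limit_proportion_weight_cvg0 :
  w n * q n @[n --> \oo] --> (0 : R).
Proof.
have D2 := D_ge2.
apply: (@squeeze_cvgr _ _ _ _ (fun=> 0) (fun n => 12 * (D + 1) * n.+1%:R^-1)).
- near=> n; rewrite mulr_ge0 ?ler0n ?(ltW (limit_proportion_gt0 _))//=.
  apply: (le_trans (ler_wpM2l (ler0n _ _) (limit_proportion_le n))).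
  rewrite ran_weightE -natr1; set x : R := n%:R.
  have x0 : 0 <= x by rewrite ler0n.
  rewrite mulrA ler_pdivrMr; last by apply: mulr_gt0; lra.
  rewrite mulrAC ler_pdivlMr; last lra.
  have : (D + 1 + x * (D - 1)) * (x + 1) <= (D + 1) * ((x + 3) * (x + 4)) by nra.
  lra.
- exact: cvg_cst.
- rewrite -[X in _ --> X](mulr0 (12 * (D + 1))).
  by apply: cvgM; [exact: cvg_cst|exact: cvg_harmonic].
Unshelve. all: end_near. Qed.

Lemma cvg_sum_limit_proportion :
  \sum_(l < n.+1) q l @[n --> \oo] --> (1 : R).
Proof.
have D2 := D_ge2.
have -> : (fun n => \sum_(l < n.+1) q l) = (fun n => 1 - D^-1 * (w n * q n)).
  apply/funext => n; have D0 : D != 0 by lra.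
  apply: (mulfI D0); rewrite sum_limit_proportion; field; exact: D0.
rewrite -[X in _ --> X](_ : 1 - D^-1 * 0 = 1); last by rewrite mulr0 subr0.
apply: cvgB; first exact: cvg_cst.
by apply: cvgM; [exact: cvg_cst|exact: limit_proportion_weight_cvg0].
Qed.

Lemma sum_limit_proportion_le1 n : \sum_(l < n) q l <= 1.
Proof.
have D2 := D_ge2; case: n => [|n]; first by rewrite big_ord0.
rewrite -(@ler_pM2l _ D); last lra.
rewrite sum_limit_proportion mulr1 gerBl.
by rewrite mulr_ge0// ltW// limit_proportion_gt0.
Qed.

Let alpha : R := 2 / (D - 1).

(** After division by [D - 1] the factors [w l] and [D + w l.+1] of the recursion become [a l] and
    [b l], which grow by 1 with [l]. Hence both sides are multiplied by [a l / b l] at each step,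
    the right one by the functional equation of [Gamma]. *)
Lemma limit_proportion_Gamma l :
  q l = D / (2 * D + 1)
        * (Gamma (l%:R + 1 + alpha) / Gamma (1 + alpha))
        * (Gamma (2 + (D + 2) / (D - 1))
           / Gamma (l%:R + 2 + (D + 2) / (D - 1))).
Proof.
have D2 := D_ge2.
have a0 : 0 < alpha by apply: divr_gt0; lra.
have b0 : 0 < (D + 2) / (D - 1) by apply: divr_gt0; lra.
have Gneq0 (x : R) : 1 < x -> Gamma x != 0 by move=> x1; rewrite gt_eqF ?Gamma_gt0.
pose a (m : nat) := m%:R + 1 + alpha.
pose b (m : nat) := m%:R + 2 + (D + 2) / (D - 1).
rewrite -/(a l) -/(b l).
have b_gt1 m : 1 < b m by have m0 : 0 <= m%:R :> R by []; rewrite /b; lra.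
have a_gt1 m : 1 < a m by have m0 : 0 <= m%:R :> R by []; rewrite /a; lra.
have aS m : a m.+1 = a m + 1 by rewrite /a -natr1; ring.
have bS m : b m.+1 = b m + 1 by rewrite /b -natr1; ring.
have wa m : w m = (D - 1) * a m by rewrite ran_weightE /a /alpha; field; lra.
have wb m : D + w m.+1 = (D - 1) * b m.
  by rewrite ran_weightE -natr1 /b; field; lra.
have -> : 1 + alpha = a 0 by rewrite /a add0r.
have -> : 2 + (D + 2) / (D - 1) = b 0 by rewrite /b add0r.
have D1 : D - 1 != 0 by rewrite gt_eqF//; lra.
clearbody a b; elim: l => [|l IH].
  by rewrite !divff ?Gneq0// !mulr1.
have bl_neq0 : b l != 0 by rewrite gt_eqF// (lt_trans ltr01).
have -> : q l.+1 = q l * (a l / b l).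
  apply: (mulfI D1); apply: (mulIf bl_neq0).
  rewrite mulrAC -wb -limit_proportionS wa; move: bl_neq0.
  by move: (q l) (a l) (b l) => ql al bl bl0; field.
rewrite IH aS bS !GammaS//.
have := Gneq0 _ (b_gt1 l); have := Gneq0 _ (a_gt1 0%N).
move: bl_neq0.
move: (Gamma (a l)) (Gamma (b 0)) (Gamma (a 0)) (Gamma (b l)) (a l) (b l).
move: (D / (2 * D + 1)) => c ga gb0 ga0 gb al bl bl_neq0 ga0_neq0 gb_neq0.
by field; rewrite bl_neq0 ga0_neq0 gb_neq0.
Qed.

Let tau : R := (2 * D - 1) / (D - 1).

Let tau_ge1 : 1 <= tau.
Proof. by have D2 := D_ge2; rewrite ler_pdivlMr; lra. Qed.

Let y (l : nat) : R := l%:R + 1 + alpha.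

Let y_gt0 l : 0 < y l.
Proof.
have D2 := D_ge2; have a0 : 0 < alpha by apply: divr_gt0; lra.
by have l0 : 0 <= l%:R :> R by []; rewrite /y; lra.
Qed.

(** The denominator exceeds the numerator by exactly [tau], which is why [tau] is the exponent of
    decay. *)
Let ratio l : q l.+1 * (y l + tau) = q l * y l.
Proof.
have D2 := D_ge2; have D1 : D - 1 != 0 by rewrite gt_eqF; lra.
apply: (mulfI D1).
have -> : (D - 1) * (q l * y l) = w l * q l.
  by rewrite ran_weightE /y /alpha; field.
by rewrite limit_proportionS ran_weightE -natr1 /y /alpha /tau; field.
Qed.

Let yS l : y l.+1 = y l + 1.
Proof. by rewrite /y -natr1; ring. Qed.

Let u l := q l * y l `^ tau.
Let v l := q l * (y l + tau - 1) `^ tau.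

Let u_nondecreasing : nondecreasing_seq u.
Proof.
apply/nondecreasing_seqP => l; have y0 := y_gt0 l; have t1 := tau_ge1.
(* The ratio [(y l + tau) / y l] is written as the linear side of Bernoulli's inequality at
   [m = (y l + 1) / y l]. *)
have -> : u l = q l.+1 * (y l `^ tau * (1 + tau * ((y l + 1) / y l - 1))).
  have -> : q l.+1 = q l * y l / (y l + tau).
    by rewrite -ratio mulfK// gt_eqF//; lra.
  by rewrite /u; field; rewrite !gt_eqF//; lra.
rewrite /u yS; apply: ler_wpM2l; first exact/ltW/limit_proportion_gt0.
have {2}-> : y l + 1 = y l * ((y l + 1) / y l) by field; rewrite gt_eqF.
rewrite powRM; [|lra|by apply: divr_ge0; lra].
by rewrite ler_wpM2l ?powR_ge0// bernoulli_powR// divr_gt0//; lra.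
Qed.

Let v_nonincreasing : nonincreasing_seq v.
Proof.
apply/nonincreasing_seqP => l; have y0 := y_gt0 l; have t1 := tau_ge1.
pose z := y l + tau; have z1 : 1 < z by rewrite /z; lra.
(* Here the factor [y l / z] of the recursion, that is [1 - tau / z], is the linear side of
   Bernoulli's inequality at [m = (z - 1) / z]. *)
have -> : v l.+1 = q l * (z `^ tau * (1 + tau * ((z - 1) / z - 1))).
  have -> : 1 + tau * ((z - 1) / z - 1) = y l / z.
    by rewrite /z; field; rewrite gt_eqF//; lra.
  rewrite /v yS (_ : y l + 1 + tau - 1 = z); last by rewrite /z; ring.
  have -> : q l.+1 = q l * y l / z by rewrite -ratio mulfK// gt_eqF//; lra.
  by rewrite -!mulrA [_^-1 * _]mulrC !mulrA [_ * _ * y l]mulrAC.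
rewrite /v -/z; apply: ler_wpM2l; first exact/ltW/limit_proportion_gt0.
have {2}-> : z - 1 = z * ((z - 1) / z) by field; rewrite gt_eqF//; lra.
rewrite powRM; [|lra|by apply: divr_ge0; lra].
by rewrite ler_wpM2l ?powR_ge0// bernoulli_powR// divr_gt0//; lra.
Qed.

Let u_le_v l : u l <= v l.
Proof.
have y0 := y_gt0 l; have t1 := tau_ge1.
apply: ler_wpM2l; first exact/ltW/limit_proportion_gt0.
by apply: ge0_ler_powR; rewrite ?nnegrE; lra.
Qed.

(** [u] is nondecreasing and bounded by [v 0], so it converges, to a limit at least [u 0 > 0]. Only
    the base of the power then has to be changed from [y l] to [l + d + 1]. *)
Lemma limit_proportion_power_law :
  exists2 K : R, 0 < K & q l * (l + d.+1)%:R `^ tau @[l --> \oo] --> K.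
Proof.
have cvg_u : cvgn u.
  apply: nondecreasing_is_cvgn => //; exists (v 0) => _ [l _ <-].
  by apply: le_trans (u_le_v l) _; exact: v_nonincreasing.
exists (limn u).
  apply: (@lt_le_trans _ _ (u 0)); last exact: nondecreasing_cvgn_le.
  by rewrite mulr_gt0 ?limit_proportion_gt0// powR_gt0.
(* [r l] is the quotient of [l + d + 1] by [y l]; their difference is the constant [D - alpha], so
   [r] tends to 1. *)
pose r (l : nat) : R := 1 + (D - alpha) / y l.
have -> : (fun l => q l * (l + d.+1)%:R `^ tau) = (fun l => u l * r l `^ tau).
  apply/funext => l; rewrite /u -mulrA; congr (_ * _).
  have E : (l + d.+1)%:R = y l * r l.
    rewrite /r mulrDr mulr1 mulrCA divff ?gt_eqF// mulr1 /y natrD -natr1; ring.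
  by rewrite E powRM ?(ltW (y_gt0 l))// -(pmulr_rge0 _ (y_gt0 l)) -E.
rewrite -[X in _ --> X]mulr1; apply: cvgM => //.
rewrite -[X in _ --> X](_ : 1 `^ tau = 1); last by rewrite powR1.
have cvg_r : r l @[l --> \oo] --> (1 : R).
  rewrite -[X in _ --> X](_ : 1 + (D - alpha) * 0 = 1); last by rewrite mulr0 addr0.
  apply: cvgD; first exact: cvg_cst.
  apply: cvgM; first exact: cvg_cst.
  apply/gtr0_cvgV0; first by near=> l; exact: y_gt0.
  have -> : y = (fun x : R => x + (1 + alpha)) \o (fun l => l%:R).
    by apply/funext => l; rewrite /y/= addrA.
  by apply: (cvg_comp _ _ cvgr_idn); exact: cvg_addrr.
apply: (@cvg_comp _ _ _ r (fun x : R => x `^ tau) _ _ _ cvg_r).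
have [+ _] := is_derive1_powR tau (@ltr01 R).
by move=> /derivable1_diffP/differentiable_continuous.
Unshelve. all: end_near. Qed.

End limit_proportion.

(** * Counting in the cliques created by an insertion *)

Section subcliques.
Variables (v : nat) (K : {fset nat}).
Hypothesis vK : v \notin K.

(** The omitted element is the only one of [K] that is absent, as [v] is not in [K]. So sums over
    the new cliques can be indexed by [K]. *)
Lemma subcliques_inj : {in K &, injective (fun x => v |` (K `\ x))}%fset.
Proof.
move=> x y xK yK /= /fsetP/(_ x); rewrite !inE eqxx/= xK andbT.
by rewrite (negbTE (memPn vK x xK))/= => /esym/negbFE/eqP.
Qed.

Lemma sum_subcliques (F : {fset nat} -> nat) :
  (\sum_(A <- subcliques v K) F A = \sum_(x <- K) F (v |` (K `\ x))%fset)%N.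
Proof. by rewrite /subcliques big_imfset//; exact: subcliques_inj. Qed.

(** The new vertex lies in every new clique, an element of [K] in all of them but the one that omits
    it. *)
Lemma sum_mem_subcliques (i : nat) :
  (\sum_(A <- subcliques v K) (i \in A) =
   if i == v then #|` K| else (i \in K) * #|` K|.-1)%N.
Proof.
rewrite sum_subcliques; case: eqVneq => [->|iv].
  under eq_bigr do rewrite !inE eqxx/=.
  by rewrite sum1_size.
under eq_bigr do rewrite !inE (negbTE iv)/=.
have [iK|iK] := boolP (i \in K); last first.
  by rewrite big1// => x _; rewrite andbF.
rewrite (big_fsetD1 i)//= eqxx add0n mul1n (cardfsD1 i) iK/=.
rewrite -sum1_size big_seq [RHS]big_seq; apply: eq_bigr => x.
by rewrite !inE andbT eq_sym => /andP[->].
Qed.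

Lemma mem_subcliques (A : {fset nat}) : A \in subcliques v K -> v \in A.
Proof. by move=> /imfsetP[x _ ->]; rewrite !inE eqxx. Qed.

Lemma card_subclique (A : {fset nat}) : A \in subcliques v K -> #|` A| = #|` K|.
Proof.
move=> /imfsetP[x /= xK ->].
by rewrite cardfsU1 !inE (negbTE vK) andbF/= (cardfsD1 x K) xK.
Qed.

Lemma subclique_sub (A : {fset nat}) i :
  A \in subcliques v K -> i \in A -> (i == v) || (i \in K).
Proof. by move=> /imfsetP[x _ ->]; rewrite !inE; case: eqVneq => //= _ /andP[]. Qed.

End subcliques.

Lemma sum_mem_fset (K : {fset nat}) (o : nat) :
  (forall i, i \in K -> (i < o)%N) -> (\sum_(0 <= j < o) (j \in K) = #|` K|)%N.
Proof.
move=> Ko; rewrite -sum1_size -big_mkcond/= -big_filter; apply: perm_big.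
apply: uniq_perm; rewrite ?filter_uniq ?iota_uniq ?fset_uniq//.
move=> i; rewrite mem_filter mem_index_iota/= andbC.
by apply: andb_idl => /Ko.
Qed.

(** * The invariant of the network, initially and after an insertion *)

Lemma degreeE d n G i :
  degree d n G i = (\sum_(0 <= j < ran_order d n) adj G i j)%N.
Proof.
rewrite /degree big_mkord -sum1_card big_mkcond/=.
by apply: eq_bigr => j _; rewrite inE; case: adj.
Qed.

Record ran_inv (d n : nat) (G : network) : Prop := RanInv {
  ran_active_card : #|` active G| = (d.+1 + d * n)%N;
  ran_clique_card : forall K, K \in active G -> #|` K| = d.+1;
  ran_clique_lt : forall K i, K \in active G -> i \in K -> (i < ran_order d n)%N;
  ran_adj_lt : forall i j,
    adj G i j -> (i < ran_order d n)%N && (j < ran_order d n)%N;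
  ran_degree_ge : forall i, (d < i < ran_order d n)%N -> (d < degree d n G i)%N;
  (* Inserting a vertex into a clique through i removes one active clique
     through i and creates d of them. *)
  ran_sum_mem : forall i, (d < i < ran_order d n)%N ->
    (\sum_(K <- active G) (i \in K) = ran_weight d (degree d n G i - d.+1))%N }.

Lemma ran_orderS d n : ran_order d n.+1 = (ran_order d n).+1.
Proof. by rewrite /ran_order. Qed.

Lemma ran_order0 d : ran_order d 0 = d.+2.
Proof. by rewrite /ran_order add0n addn2. Qed.

Lemma degree_init d : degree d 0 (ran_init d) d.+1 = d.+1.
Proof.
rewrite degreeE ran_order0 big_nat_recr//= eqxx !andbF addn0.
rewrite big_mkord -[RHS]card_ord -sum1_card; apply: eq_bigr => j _.
by have jd := ltn_ord j; rewrite ltnSn/= ltnW//= gtn_eqF.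
Qed.

Lemma ran_inv_init d : ran_inv d 0 (ran_init d).
Proof.
have memS i : (i \in simplex d) = (i < d.+1)%N.
  apply/imfsetP/idP => [[j + ->]|id]; first by rewrite [_ \in _]mem_iota.
  by exists i => //; rewrite [_ \in _]mem_iota.
have vS : d.+1 \notin simplex d by rewrite memS ltnn.
have cS : #|` simplex d| = d.+1.
  rewrite -(@sum_mem_fset _ d.+1); last by move=> i; rewrite memS.
  rewrite big_mkord -[RHS]card_ord -sum1_card; apply: eq_bigr => i _.
  by rewrite memS ltn_ord.
have o0 := ran_order0 d.
have deg i : (d < i < d.+2)%N -> i = d.+1 /\ degree d 0 (ran_init d) i = d.+1.
  move=> di; have -> : i = d.+1 by lia.
  by split; last exact: degree_init.
split => /=.
- by rewrite -sum1_size sum_subcliques// sum1_size muln0 addn0.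
- by move=> K /(card_subclique vS) ->.
- by move=> K i /subclique_sub + iK => /(_ _ iK); rewrite o0 memS => /orP[/eqP->|/ltnW].
- by move=> i j; rewrite o0 => /and3P[-> ->].
- by move=> i; rewrite o0 => /deg[_ ->].
- move=> i; rewrite o0 => /deg[-> ->].
  by rewrite sum_mem_subcliques// eqxx subnn /ran_weight mul0n addn0 cS.
Qed.

Section insertion.
Variables (d n : nat) (G : network) (K : {fset nat}).
Hypothesis d_gt0 : (0 < d)%N.
Hypotheses (invG : ran_inv d n G) (KG : K \in active G).
Local Notation o := (ran_order d n).
Local Notation G' := (ran_insert o K G).

Let oA A : A \in active G -> o \notin A.
Proof. by move=> AG; apply/negP => /(ran_clique_lt invG AG); rewrite ltnn. Qed.

Let oK : o \notin K. Proof. exact: oA. Qed.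

Let cK : #|` K| = d.+1. Proof. exact: (ran_clique_card invG). Qed.

Let Ko i : i \in K -> (i < o)%N. Proof. exact: (ran_clique_lt invG). Qed.

(** The new cliques contain the new vertex and the old ones do not, so the union is disjoint. The
    term [F K] stands on the left to avoid truncated subtraction. *)
Lemma sum_active_insert (F : {fset nat} -> nat) :
  (\sum_(A <- active G') F A + F K =
   \sum_(A <- active G) F A + \sum_(A <- subcliques o K) F A)%N.
Proof.
rewrite (perm_big ((active G `\ K)%fset ++ subcliques o K))/=.
  by rewrite big_cat/= [in RHS](big_fsetD1 K)//= addnAC [(_ + F K)%N]addnC.
apply: uniq_perm; rewrite ?fset_uniq//.
  rewrite cat_uniq !fset_uniq andbT/=; apply/hasPn => A /mem_subcliques oA'.
  by apply/negP => /fsetD1P[_ /oA]; rewrite oA'.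
by move=> A; rewrite mem_cat in_fsetU.
Qed.

Lemma degree_insert i : (i < o)%N ->
  degree d n.+1 G' i = (degree d n G i + (i \in K))%N.
Proof.
move=> io; rewrite !degreeE ran_orderS big_nat_recr//=; congr addn.
  apply: eq_big_nat => j /andP[_ jo].
  by rewrite (ltn_eqF io) (ltn_eqF jo)/= orbF.
rewrite eqxx (ltn_eqF io)/=.
have [/(ran_adj_lt invG)|//] := boolP (adj G i o).
by rewrite ltnn andbF.
Qed.

Lemma degree_insert_new : degree d n.+1 G' o = d.+1.
Proof.
rewrite degreeE ran_orderS big_nat_recr//= eqxx (negbTE oK).
have adjo j : adj G o j = false.
  by apply/negP => /(ran_adj_lt invG); rewrite ltnn.
rewrite adjo addn0 -cK -(sum_mem_fset Ko).
by apply: eq_big_nat => j /andP[_ jo]; rewrite adjo (ltn_eqF jo)/= orbF.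
Qed.

Lemma ran_inv_insert : ran_inv d n.+1 G'.
Proof.
split.
- have := sum_active_insert (fun=> 1%N).
  rewrite (sum_subcliques oK) !sum1_size cK (ran_active_card invG) /=.
  by rewrite mulnS; lia.
- move=> A; rewrite in_fsetU => /orP[/fsetD1P[_]|/(card_subclique oK) ->//].
  exact: (ran_clique_card invG).
- move=> A i; rewrite in_fsetU ran_orderS => /orP[/fsetD1P[_ AG]|AG] iA.
    exact/ltnW/(ran_clique_lt invG AG iA).
  by have /orP[/eqP->//|/Ko/ltnW] := subclique_sub AG iA.
- move=> i j; rewrite ran_orderS /= => /or3P[/(ran_adj_lt invG)/andP[]||].
  + by move=> /ltnW io /ltnW jo; rewrite !ltnS io jo.
  + by move=> /andP[/eqP-> /Ko /ltnW jo]; rewrite !ltnS leqnn jo.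
  + by move=> /andP[/eqP-> /Ko /ltnW io]; rewrite !ltnS leqnn io.
- move=> i /andP[di]; rewrite ran_orderS ltnS leq_eqVlt => /orP[/eqP->|io].
    by rewrite degree_insert_new.
  by rewrite degree_insert// ltn_addr// (ran_degree_ge invG)// di.
- move=> i /andP[di]; rewrite ran_orderS ltnS leq_eqVlt.
  have := sum_active_insert (fun A => i \in A).
  rewrite sum_mem_subcliques// cK/= => + /orP[/eqP io|io].
    rewrite io eqxx degree_insert_new (negbTE oK) addn0 => ->.
    rewrite subnn /ran_weight mul0n addn0 big_seq big1// => A /oA.
    by move=> /negbTE ->.
  rewrite (ltn_eqF io) degree_insert// (ran_sum_mem invG) ?di//.
  (* The degree is at least [d + 1], so the truncated subtraction in the level is exact and commutes
     with the successor. *)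
  have := @ran_degree_ge _ _ _ invG i; rewrite di io => /(_ isT).
  case: (i \in K) => /= degi; last by rewrite !addn0.
  have -> : (degree d n G i + 1 - d.+1 = (degree d n G i - d.+1).+1)%N by lia.
  by rewrite /ran_weight mulSn; lia.
Qed.

End insertion.

(** * The number of vertices at each level, and its change in one step *)

(** Level [l] stands for degree [d + 1 + l]. The initial simplex is left out: each of its vertices
    has degree [d + 1] at the start but lies in only [d] active cliques, so it does not follow
    [ran_weight]. *)
Definition level_count (d n : nat) (G : network) (l : nat) : nat :=
  (\sum_(d.+1 <= i < ran_order d n) (degree d n G i == d.+1 + l))%N.

Definition clique_level_count d n G (K : {fset nat}) (l : nat) : nat :=
  (\sum_(d.+1 <= i < ran_order d n) (i \in K) * (degree d n G i == d.+1 + l))%N.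

Lemma d_lt_order d n : (d < ran_order d n)%N.
Proof. by rewrite /ran_order; lia. Qed.

Lemma level_count_init d l : level_count d 0 (ran_init d) l = (l == 0)%N.
Proof.
rewrite /level_count ran_order0 big_nat1 degree_init.
by rewrite -[X in X == _]addn0 eqn_add2l eq_sym.
Qed.

(** Choosing [K] moves each of its counted vertices up one level, and the new vertex enters at level
    0. *)
Lemma level_count_insert d n G K l : ran_inv d n G -> K \in active G ->
  (level_count d n.+1 (ran_insert (ran_order d n) K G) l
     + clique_level_count d n G K l =
   level_count d n G l
     + (if l is l'.+1 then clique_level_count d n G K l' else 1))%N.
Proof.
move=> invG KG; rewrite /level_count ran_orderS big_nat_recr ?d_lt_order//=.
rewrite (degree_insert_new invG KG).
have -> : (d.+1 == d.+1 + l) = (l == 0)%N.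
  by rewrite -[X in X == _]addn0 eqn_add2l eq_sym.
rewrite addnAC -big_split/=.
have degi i : (d < i < ran_order d n)%N -> (d < degree d n G i)%N.
  exact: (ran_degree_ge invG).
case: l => [|l] /=.
  congr addn; apply: eq_big_nat => i di; move: (di) => /andP[_ io].
  rewrite (degree_insert K invG io); have := degi _ di.
  by case: (i \in K) => /=; lia.
rewrite addn0 -big_split/=; apply: eq_big_nat => i di; move: (di) => /andP[_ io].
rewrite (degree_insert K invG io); have := degi _ di.
by case: (i \in K) => /=; lia.
Qed.

(** Double counting of pairs of an active clique and a vertex of level [l] in it. *)
Lemma sum_clique_level_count d n G l : ran_inv d n G ->
  (\sum_(K <- active G) clique_level_count d n G K l =
   ran_weight d l * level_count d n G l)%N.
Proof.
move=> invG; rewrite /clique_level_count exchange_big/= big_distrr/=.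
apply: eq_big_nat => i di; rewrite -big_distrl/= (ran_sum_mem invG)//.
by case: eqP => [->|]; rewrite ?muln0// addKn.
Qed.

(** Each of the [d + 1] vertices of [K] has at most one level. *)
Lemma sum_clique_level_count_le d n G K L : ran_inv d n G -> K \in active G ->
  (\sum_(l < L) clique_level_count d n G K l <= d.+1)%N.
Proof.
move=> invG KG; rewrite /clique_level_count exchange_big/=.
rewrite -[leqRHS](ran_clique_card invG KG).
rewrite -[leqRHS](sum_mem_fset (fun i => ran_clique_lt invG KG)).
rewrite [leqRHS](big_cat_nat (n := d.+1)) ?d_lt_order//=.
apply: leq_trans (leq_addl _ _).  apply: leq_sum => i _.
rewrite -big_distrr/=; case: (i \in K); rewrite ?mul0n// mul1n.
rewrite -big_mkcond/= sum1_card.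
apply/card_le1P => l; rewrite unfold_in => /eqP El l'.
rewrite [LHS]unfold_in El [LHS](eqn_add2l d.+1 l l').
by rewrite inE eq_sym.
Qed.

(** * Histories of the process, enumerated *)

(* The network built by a history, listed from the last choice to the first. *)
Fixpoint history_network (d : nat) (s : seq {fset nat}) : network :=
  if s is K :: s' then
    ran_insert (ran_order d (size s')) K (history_network d s')
  else ran_init d.

Fixpoint histories (d n : nat) : seq (seq {fset nat}) :=
  if n is m.+1 then
    flatten [seq [seq K :: s | K <- active (history_network d s)]
            | s <- histories d m]
  else [:: [::]].

Lemma histories_inv d n s : (0 < d)%N -> s \in histories d n ->
  size s = n /\ ran_inv d n (history_network d s).
Proof.
move=> d0; elim: n s => [|n IH] s /=.
  by rewrite inE => /eqP->; split => //; exact: ran_inv_init.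
move=> /flatten_mapP[t /IH[st invt]] /mapP[K Kt ->] /=.
by rewrite st; split => //; exact: ran_inv_insert.
Qed.

Lemma histories_uniq d n : uniq (histories d n).
Proof.
elim: n => [//|n IH] /=; apply: allpairs_uniq_dep => //.
  by move=> s _; exact: fset_uniq.
by move=> [s K] [s' K'] _ _ /= [-> ->].
Qed.

(** The number of active cliques depends on [n] only, so every history of length [n] has equally
    many extensions; this is what makes histories of equal length equally likely. *)
Lemma size_histories d n : (0 < d)%N ->
  size (histories d n.+1) = ((d.+1 + d * n) * size (histories d n))%N.
Proof.
move=> d0; rewrite /= size_flatten /shape -map_comp sumnE big_map big_seq.
rewrite (eq_bigr (fun=> (d.+1 + d * n)%N)); last first.
  move=> s /(histories_inv d0)[_ invs] /=.
  by rewrite size_map (ran_active_card invs).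
by rewrite -big_seq big_const_seq count_predT iter_addn_0.
Qed.

Lemma size_histories_gt0 d n : (0 < d)%N -> (0 < size (histories d n))%N.
Proof. by move=> d0; elim: n => // n IH; rewrite size_histories// muln_gt0 IH. Qed.

(** * The second moment of the deviations *)

Lemma sum_sqr_le (R : realType) (x : nat -> R) L :
  (\sum_(l < L) x l ^+ 2 <= (\sum_(l < L) `|x l|) ^+ 2).
Proof.
elim: L => [|L IH]; first by rewrite !big_ord0 expr0n.
rewrite !big_ord_recr/=; set s := \sum_(l < L) _ ^+ 2 in IH *.
set a := \sum_(l < L) _ in IH *.
have a0 : 0 <= a by apply: sumr_ge0.
by rewrite sqrrD -[x L ^+ 2]real_normK ?num_real// lerD2r ler_wpDr// mulrn_wge0// mulr_ge0.
Qed.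

(* Summing 2 x_l w_{l-1} x_{l-1} <= w_{l-1} (x_l^2 + x_{l-1}^2) telescopes. *)
Lemma transport_dissipative (R : realType) (x w : nat -> R) L :
  (forall l, 0 <= w l) -> (forall l, w l <= w l.+1) ->
  \sum_(l < L) x l * ((if (l : nat) is l'.+1 then w l' * x l' else 0) - w l * x l) <= 0.
Proof.
move=> w0 wS; case: L => [|L]; first by rewrite big_ord0.
suff : 2 * (\sum_(l < L.+1) x l *
      ((if (l : nat) is l'.+1 then w l' * x l' else 0) - w l * x l))
    <= - (w L * x L ^+ 2).
  have : 0 <= w L * x L ^+ 2 by rewrite mulr_ge0// sqr_ge0.
  lra.
elim: L => [|L IH].
  rewrite big_ord1 sub0r expr2; have := mulr_ge0 (w0 0) (sqr_ge0 (x 0)); lra.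
rewrite big_ord_recr/= mulrDr.
have h1 : 0 <= w L * (x L - x L.+1) ^+ 2 by rewrite mulr_ge0// sqr_ge0.
have h2 : 0 <= (w L.+1 - w L) * x L.+1 ^+ 2.
  by rewrite mulr_ge0 ?sqr_ge0// subr_ge0.
lra.
Qed.

Section second_moment.
Variables (R : realType) (d : nat).
Hypothesis d_ge2 : (2 <= d)%N.
Local Notation D := (d%:R : R).
Local Notation q := (limit_proportion R d).
Local Notation w l := ((ran_weight d l)%:R : R).

Let d_gt0 : (0 < d)%N. Proof. exact: ltnW. Qed.
Let D_ge2 : 2 <= D. Proof. by rewrite ler_nat. Qed.
Let D_neq0 : D != 0. Proof. by rewrite pnatr_eq0 -lt0n. Qed.

Definition clique_number (n : nat) : R := (d.+1 + d * n)%:R.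

Definition level_deviation n G l : R :=
  (level_count d n G l)%:R - clique_number n / D * q l.

Definition square_deviation n L G : R := \sum_(l < L) level_deviation n G l ^+ 2.

Definition noise_bound : R := (2 * D + 4) ^+ 2.

Lemma clique_numberE n : clique_number n = D + 1 + D * n%:R.
Proof. by rewrite /clique_number natrD natrM -addn1 natrD. Qed.

Lemma clique_number_gt0 n : 0 < clique_number n.
Proof. by rewrite ltr0n. Qed.

Let increment n G K l : R :=
  (if l is l'.+1 then clique_level_count d n G K l' else 1%N)%:R
  - (clique_level_count d n G K l)%:R - q l.

(** The term [- q l] of [increment] arises because [clique_number n / D] grows by exactly 1 per
    step. *)
Let level_deviation_insert n G K l : ran_inv d n G -> K \in active G ->
  level_deviation n.+1 (ran_insert (ran_order d n) K G) l =
  level_deviation n G l + increment n G K l.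
Proof.
move=> invG KG; rewrite /level_deviation /increment.
have /(congr1 (fun m => m%:R : R)) := level_count_insert l invG KG.
rewrite !natrD !clique_numberE -natr1 => E.
have -> : (D + 1 + D * (n%:R + 1)) / D = (D + 1 + D * n%:R) / D + 1.
  by field; exact: D_neq0.
rewrite mulrDl mul1r; lra.
Qed.

(** The centring solves the mean recursion exactly, so the contribution of the new vertex and the
    terms [- q l] cancel, and the drift is linear in the deviations. *)
Let sum_increment n G l : ran_inv d n G ->
  \sum_(K <- active G) increment n G K l =
  (if l is l'.+1 then w l' * level_deviation n G l' else 0)
  - w l * level_deviation n G l.
Proof.
move=> invG; rewrite !sumrB -!natr_sum.
rewrite (sum_clique_level_count l invG).
have -> : \sum_(K <- active G) q l = clique_number n * q l.
  rewrite big_const_seq count_predT iter_addr addr0.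
  by rewrite (ran_active_card invG) -mulr_natl.
rewrite /level_deviation; case: l => [|l].
  rewrite sum1_size (ran_active_card invG) -/(clique_number n) natrM.
  have E : w 0 * q 0 = D - D * q 0 by have := limit_proportion0 R d_ge2; lra.
  rewrite mulrBr [w 0 * (_ * _)]mulrCA E; field; exact: D_neq0.
rewrite (sum_clique_level_count l invG) !natrM.
have E : w l * q l = D * q l.+1 + w l.+1 * q l.+1.
  by have := limit_proportionS R d_ge2 l; lra.
rewrite !mulrBr [w l * (_ * _)]mulrCA [w l.+1 * (_ * _)]mulrCA E.
field; exact: D_neq0.
Qed.

(** The sum of the absolute increments is at most [(D + 2) + (D + 1) + 1]: arrivals including the
    new vertex, departures, and the total mass of [q]. *)
Let sum_increment_sqr_le n G K L : ran_inv d n G -> K \in active G ->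
  \sum_(l < L) increment n G K l ^+ 2 <= noise_bound.
Proof.
move=> invG KG; apply: le_trans (sum_sqr_le _ _) _.
have aL M : \sum_(l < M) (clique_level_count d n G K l)%:R <= D + 1.
  by rewrite -natr_sum natr1 ler_nat (sum_clique_level_count_le _ invG KG).
have a0 : \sum_(l < L) (if (l : nat) is l'.+1 then clique_level_count d n G K l'
    else 1%N)%:R <= D + 2.
  case: L => [|L]; first by rewrite big_ord0; have := D_ge2; lra.
  by rewrite big_ord_recl/=; have := aL L; lra.
have h : \sum_(l < L) `|increment n G K l| <= 2 * D + 4.
  apply: (@le_trans _ _ (\sum_(l < L)
    ((if (l : nat) is l'.+1 then clique_level_count d n G K l' else 1%N)%:R
     + (clique_level_count d n G K l)%:R + q l))).
    apply: ler_sum => l _; rewrite /increment.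
    have q0 := limit_proportion_gt0 R d_ge2 l.
    set a : R := (if _ is _.+1 then _ else _)%:R; set b : R := _%:R.
    have a_ge0 : 0 <= a by []. have b_ge0 : 0 <= b by [].
    by rewrite ler_norml; lra.
  rewrite !big_split/=; have := aL L; have := sum_limit_proportion_le1 R d_ge2 L.
  by move: a0; lra.
by rewrite /noise_bound ler_sqr ?nnegrE//; apply: sumr_ge0.
Qed.

(** The square of deviation plus increment is expanded and summed over the choices: the cross term
    is the drift, nonpositive by [transport_dissipative], and the squared increments are at most
    [noise_bound] per clique. *)
Lemma sum_square_deviation_insert n G L : ran_inv d n G ->
  \sum_(K <- active G) square_deviation n.+1 L (ran_insert (ran_order d n) K G)
  <= clique_number n * (square_deviation n L G + noise_bound).
Proof.
move=> invG.
have -> : \sum_(K <- active G) square_deviation n.+1 L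
      (ran_insert (ran_order d n) K G) =
   clique_number n * square_deviation n L G
   + 2 * (\sum_(l < L) level_deviation n G l *
       ((if (l : nat) is l'.+1 then w l' * level_deviation n G l' else 0)
        - w l * level_deviation n G l))
   + \sum_(K <- active G) \sum_(l < L) increment n G K l ^+ 2.
  rewrite [X in _ + X]exchange_big/= mulr_sumr /square_deviation mulr_sumr.
  rewrite -!big_split/= exchange_big/=; apply: eq_bigr => l _.
  rewrite -sum_increment// !mulr_sumr.
  have -> : clique_number n * level_deviation n G l ^+ 2
      = \sum_(K <- active G) level_deviation n G l ^+ 2.
    rewrite big_const_seq count_predT iter_addr addr0.
    by rewrite (ran_active_card invG) -mulr_natl.
  rewrite -!big_split/= big_seq [RHS]big_seq; apply: eq_bigr => K KG.
  by rewrite level_deviation_insert//; ring.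
rewrite mulrDr -addrA lerD2l.
have := @transport_dissipative R (level_deviation n G) (fun l => w l) L.
move=> /(_ (fun=> ler0n _ _)) drift.
have {}drift := drift (fun l => _ : w l <= w l.+1).
have noise : \sum_(K <- active G) \sum_(l < L) increment n G K l ^+ 2
    <= clique_number n * noise_bound.
  have -> : clique_number n * noise_bound = \sum_(K <- active G) noise_bound.
    rewrite big_const_seq count_predT iter_addr addr0.
    by rewrite (ran_active_card invG) -mulr_natl.
  rewrite big_seq [leRHS]big_seq; apply: ler_sum => K KG.
  exact: sum_increment_sqr_le.
rewrite -[leRHS]add0r; apply: lerD noise.
rewrite pmulr_rle0//; apply: drift => l.
by rewrite ler_nat leq_add2l leq_mul2r leqnSn orbT.
Qed.

Lemma square_deviation_init_le L : square_deviation 0 L (ran_init d) <= 9.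
Proof.
have D2 := D_ge2; apply: le_trans (sum_sqr_le _ _) _.
have cD : clique_number 0 / D <= 2.
  by rewrite clique_numberE mulr0 addr0 ler_pdivrMr; lra.
have c0 : 0 <= clique_number 0 / D by rewrite divr_ge0//; lra.
have sq := sum_limit_proportion_le1 R d_ge2 L.
have sq0 : 0 <= \sum_(l < L) q l.
  by apply: sumr_ge0 => l _; exact/ltW/limit_proportion_gt0.
(* The single counted vertex contributes 1, and the centring at most 2, as
   [clique_number 0 / D <= 2] and [q] has mass at most 1. *)
have h : \sum_(l < L) `|level_deviation 0 (ran_init d) l| <= 3.
  apply: (@le_trans _ _ (\sum_(l < L)
    (((l : nat) == 0%N)%:R + clique_number 0 / D * q l))).
    apply: ler_sum => l _; rewrite /level_deviation level_count_init.
    have q0 : 0 <= clique_number 0 / D * q l.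
      by rewrite mulr_ge0// ltW// limit_proportion_gt0.
    have b0 : 0 <= ((l : nat) == 0%N)%:R :> R by [].
    by rewrite ler_norml; lra.
  rewrite big_split/= -mulr_sumr.
  have : \sum_(l < L) ((l : nat) == 0%N)%:R <= 1 :> R.
    case: (L) => [|m]; first by rewrite big_ord0.
    by rewrite big_ord_recl/= big1 ?addr0.
  nra.
have -> : 9 = 3 ^+ 2 :> R by rewrite expr2; lra.
by rewrite ler_sqr ?nnegrE//; apply: sumr_ge0.
Qed.

Lemma sum_square_deviation_histories n L :
  \sum_(s <- histories d n) square_deviation n L (history_network d s)
  <= (size (histories d n))%:R * (9 + n%:R * noise_bound).
Proof.
elim: n => [|n IH].
  by rewrite big_seq1 mul1r mul0r addr0 square_deviation_init_le.
rewrite /= big_flatten/= big_map.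
apply: (@le_trans _ _ (\sum_(s <- histories d n) clique_number n *
    (square_deviation n L (history_network d s) + noise_bound))).
  rewrite big_seq [leRHS]big_seq; apply: ler_sum => s /(histories_inv d_gt0)[ss invs].
  rewrite big_map; under eq_bigr do rewrite /= ss.
  exact: sum_square_deviation_insert.
rewrite -mulr_sumr -/(histories d n.+1) size_histories// natrM -mulrA.
rewrite ler_wpM2l ?ler0n// big_split/= big_const_seq count_predT iter_addr addr0.
rewrite -natr1 -mulr_natl; move: IH; lra.
Qed.

Lemma markov_histories n L (t : R) : 0 < t ->
  (count (fun s => t <= square_deviation n L (history_network d s))
     (histories d n))%:R / (size (histories d n))%:R
  <= (9 + n%:R * noise_bound) / t.
Proof.
move=> t0; have H0 : 0 < (size (histories d n))%:R :> R.
  by rewrite ltr0n size_histories_gt0.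
rewrite ler_pdivrMr// mulrAC ler_pdivlMr// [leRHS]mulrC.
apply: le_trans (sum_square_deviation_histories n L).
rewrite -sum1_count natr_sum mulr_suml big_mkcond/=.
apply: ler_sum => s _; case: ifP => [|_]; first by rewrite mul1r.
by apply: sumr_ge0 => l _; exact: sqr_ge0.
Qed.

End second_moment.

(** * From level deviations to degree proportions, for a fixed network *)

Section deterministic_bound.
Variables (R : realType) (d : nat).
Hypothesis d_ge2 : (2 <= d)%N.
Local Notation D := (d%:R : R).
Local Notation q := (limit_proportion R d).

Definition limit_degree_proportion (k : nat) : R :=
  if (k <= d)%N then 0 else q (k - d.+1).

(** A degree is at most [n + d + 2], so the levels below [n + 2] are the only ones that can be
    occupied. *)
Lemma level_count_eq0 n G l : (n.+2 <= l)%N -> level_count d n G l = 0%N.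
Proof.
move=> nl; rewrite /level_count big1_seq// => i _.
have : (degree d n G i <= ran_order d n)%N.
  by rewrite /degree; apply: leq_trans (max_card _) _; rewrite card_ord.
by rewrite /ran_order => deg; case: eqP => //; lia.
Qed.

Lemma degree_countE n G k :
  #|[set i : 'I_(ran_order d n) | degree d n G i == k]%SET| =
  (\sum_(0 <= i < d.+1) (degree d n G i == k)
   + \sum_(d.+1 <= i < ran_order d n) (degree d n G i == k))%N.
Proof.
rewrite -big_cat_nat //; last exact: d_lt_order.
rewrite big_mkord -sum1_card big_mkcond/=.
by apply: eq_bigr => j _; rewrite inE; case: eqP.
Qed.

(** Below [n + 2] the deviation is one term of the sum of squares. Above, only the centring is left,
    and it is at most [(n + 2) * 12 / ((l + 3) * (l + 4)) <= 12]. *)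
Lemma level_deviation_le n G l :
  `|level_deviation R d n G l| <= Num.sqrt (square_deviation R d n n.+2 G) + 12.
Proof.
have D2 : 2 <= D by rewrite ler_nat.
have [ln|nl] := ltnP l n.+2.
  apply: (@le_trans _ _ (Num.sqrt (level_deviation R d n G l ^+ 2))).
    by rewrite sqrtr_sqr.
  apply: ler_wpDr => //; rewrite ler_sqrt /square_deviation.
    rewrite (bigD1 (Ordinal ln))//= lerDl.
    by apply: sumr_ge0 => i _; exact: sqr_ge0.
  by apply: sumr_ge0 => i _; exact: sqr_ge0.
rewrite /level_deviation level_count_eq0// sub0r normrN.
have q0 := limit_proportion_gt0 R d_ge2 l.
have B0 : 0 <= clique_number R d n / D by rewrite divr_ge0 ?(ltW (clique_number_gt0 _ _ _)).
rewrite ger0_norm ?mulr_ge0 ?(ltW q0)//.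
apply: ler_wpDl; first exact: sqrtr_ge0.
apply: le_trans (ler_wpM2l B0 (limit_proportion_le R d_ge2 l)) _.
have nl' : n%:R + 2 <= l%:R :> R by rewrite -natrD ler_nat addn2.
have n0 : 0 <= n%:R :> R by [].
have B2 : clique_number R d n / D <= n%:R + 2.
  rewrite clique_numberE ler_pdivrMr; last lra.
  lra.
apply: le_trans (ler_wpM2r _ B2) _; first by apply: divr_ge0 => //; apply: mulr_ge0; lra.
rewrite mulrA ler_pdivrMr; last by apply: mulr_gt0; lra.
nra.
Qed.

(** The error [2 * D + 14] adds three parts: 12 for the high levels, [D + 1] for the vertices of the
    initial simplex, and [D + 1] for replacing [clique_number n / D] by the order of the network. *)
Lemma degree_proportion_deviation n G k : ran_inv d n G ->
  `|degree_proportion R d n G k - limit_degree_proportion k|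
    * (ran_order d n)%:R
  <= Num.sqrt (square_deviation R d n n.+2 G) + 2 * D + 14.
Proof.
move=> invG; have D2 : 2 <= D by rewrite ler_nat.
have o0 : 0 < (ran_order d n)%:R :> R by rewrite ltr0n /ran_order addn2.
rewrite -[X in _ * X]gtr0_norm// -normrM mulrBl /degree_proportion divfK ?gt_eqF//.
rewrite degree_countE natrD.
set c : R := (\sum_(0 <= i < d.+1) _)%:R.
have c0 : 0 <= c by [].
have cD : c <= D + 1.
  rewrite natr1 ler_nat -[leqRHS]subn0 -[leqRHS]muln1 -sum_nat_const_nat.
  by apply: leq_sum => i _; exact: leq_b1.
have S0 := sqrtr_ge0 (square_deviation R d n n.+2 G).
rewrite /limit_degree_proportion; case: leqP => kd.
  rewrite mul0r subr0 [X in c + X](_ : _ = 0) ?addr0; last first.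
    rewrite big_nat_cond big1// => i; rewrite andbT => di.
    have := ran_degree_ge invG di.
    by case: eqP => // ->; rewrite ltnNge kd.
  by rewrite ger0_norm//; lra.
have [l ->] : exists l, k = (d.+1 + l)%N by exists (k - d.+1)%N; rewrite subnKC.
rewrite -/(level_count d n G l) addKn.
have -> : c + (level_count d n G l)%:R - q l * (ran_order d n)%:R =
    c + level_deviation R d n G l
    - q l * ((ran_order d n)%:R - clique_number R d n / D).
  by rewrite /level_deviation; ring.
have q0 := limit_proportion_gt0 R d_ge2 l.
have q1 : q l <= 1.
  apply: le_trans (limit_proportion_le R d_ge2 l) _.
  have l0 : 0 <= l%:R :> R by [].
  rewrite ler_pdivrMr; last by apply: mulr_gt0; lra.
  nra.
have D0 : 0 < D by lra.
have Dinv : D^-1 <= 1 by rewrite invf_le1//; lra.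
have Dinv0 : 0 < D^-1 by rewrite invr_gt0.
have oE : (ran_order d n)%:R - clique_number R d n / D = D + 1 - D^-1.
  rewrite clique_numberE /ran_order !natrD; field; lra.
have h : 0 <= q l * (D + 1 - D^-1) <= D + 1 by apply/andP; split; nra.
have := level_deviation_le n G l; rewrite oE ler_norml => X.
by rewrite ler_norml; lra.
Qed.

End deterministic_bound.

(** * The law of the history: uniform on the enumerated histories *)

Lemma eq_ran d (c c' : nat -> {fset nat}) n :
  (forall m, (m < n)%N -> c m = c' m) -> ran d c n = ran d c' n.
Proof.
elim: n => //= n IH cc'; rewrite cc'// IH// => m mn.
exact/cc'/ltnW.
Qed.

Section history_law.
Variables (R : realType) (d : nat).
Hypothesis d_gt0 : (0 < d)%N.
Variables (disp : measure_display) (T : measurableType disp).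
Variables (P : probability T R) (C : nat -> T -> {fset nat}).
Hypothesis procC : ran_process P d C.

Fixpoint history (w : T) (n : nat) : seq {fset nat} :=
  if n is m.+1 then C m w :: history w m else [::].

Lemma size_history w n : size (history w n) = n.
Proof. by elim: n => //= n ->. Qed.

Lemma ran_history w n : ran d (C ^~ w) n = history_network d (history w n).
Proof. by elim: n => //= n ->; rewrite size_history. Qed.

Lemma measurable_history n s : measurable [set w | history w n = s].
Proof.
elim: n s => [|n IH] [|K s] /=.
- by rewrite (_ : [set _ | _] = setT)//; apply/seteqP; split.
- by rewrite (_ : [set _ | _] = set0)//; apply/seteqP; split.
- by rewrite (_ : [set _ | _] = set0)//; apply/seteqP; split.
rewrite (_ : [set _ | _] = [set w | C n w = K] `&` [set w | history w n = s]).
  by apply: measurableI => //; exact: procC.1.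
by apply/seteqP; split => w /= [-> ->].
Qed.

(** Histories form a countable type, so the event is a countable union, indexed by codes, of events
    that fix the history. *)
Lemma measurable_history_pred n (Q : set (seq {fset nat})) :
  measurable [set w | Q (history w n)].
Proof.
rewrite (_ : [set _ | _] = \bigcup_(i : nat)
    (if pselect (exists2 s : seq {fset nat}, choice.unpickle i = Some s & Q s) is left e
     then [set w | history w n = projT1 (cid2 e)] else set0)).
  apply: bigcupT_measurable => i; case: pselect => // e.
  exact: measurable_history.
apply/seteqP; split => w /=.
  move=> Qw; exists (choice.pickle (history w n)) => //.
  case: pselect => [e|[]]; last by exists (history w n); rewrite ?choice.pickleK.
  by case: cid2 => s /=; rewrite choice.pickleK => -[->].
by move=> [i _]; case: pselect => // e /= ->; case: cid2.
Qed.

(** The latest choice comes first in a history, so the choice numbered [m] stands at index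
    [n - (m + 1)]. *)
Lemma history_nth w n (s : seq {fset nat}) : size s = n ->
  (forall m, (m < n)%N -> C m w = nth fset0 s (n - m.+1)) <-> history w n = s.
Proof.
elim: n s => [|n IH] [|K s]//= [ss]; split.
  move=> h; congr (_ :: _); first by have := h n (ltnSn n); rewrite subnn.
  apply/(IH _ ss) => m mn; have := h m (ltnW mn).
  by rewrite subSS -(subnSK mn).
move=> [CK hs] m; rewrite ltnS leq_eqVlt => /orP[/eqP->|mn].
  by rewrite subnn.
by rewrite subSS -(subnSK mn)/=; exact: (IH _ ss).2.
Qed.

(** Induction on [n]: each step divides by the number of active cliques, which is also the factor by
    which the number of histories grows. *)
Lemma probability_history n s :
  P [set w | history w n = s] =
  ((s \in histories d n)%:R / (size (histories d n))%:R)%:E.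
Proof.
elim: n s => [|n IH] s.
  case: s => [|K s] /=.
    rewrite (_ : [set _ | _] = setT); last by apply/seteqP; split.
    by rewrite probability_setT divr1.
  rewrite (_ : [set _ | _] = set0); last by apply/seteqP; split.
  by rewrite measure0 mul0r.
case: s => [|K s].
  rewrite (_ : [set _ | _] = set0); last by apply/seteqP; split.
  rewrite measure0 [_ \in _](_ : _ = false) ?mul0r//.
  by apply/negP => /(histories_inv d_gt0)[].
have memS : (K :: s \in histories d n.+1) =
    (s \in histories d n) && (K \in active (history_network d s)).
  apply/flatten_mapP/andP => [[t tH /mapP[K' K't [-> ->]]]//|[sH KG]].
  by exists s => //; apply/mapP; exists K.
have [ss|ss] := eqVneq (size s) n; last first.
  rewrite (_ : [set _ | _] = set0); last first.
    apply/seteqP; split => // w /= [_ E].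
    by move/eqP: ss; rewrite -E size_history.
  rewrite measure0 memS [s \in _](_ : _ = false) ?mul0r//.
  by apply/negP => /(histories_inv d_gt0)[/eqP]; rewrite (negbTE ss).
pose c m := nth fset0 s (n - m.+1).
have hs w : (forall m, (m < n)%N -> C m w = c m) <-> history w n = s.
  exact: history_nth.
have ranc : ran d c n = history_network d s.
  rewrite /c -ss; elim: (s) => //= K' s' E; rewrite subnn /=; congr ran_insert.
  by rewrite -E; apply: eq_ran => m ms; rewrite subSS -(subnSK ms).
rewrite (_ : [set _ | _] =
    [set w | (forall m, (m < n)%N -> C m w = c m) /\ C n w = K]); last first.
  by apply/seteqP; split => w /= [] => [-> /hs|/hs -> ->].
rewrite procC.2 ranc (_ : [set _ | _] = [set w | history w n = s]); last first.
  by apply/seteqP; split => w /= /hs.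
rewrite IH memS -EFinM; congr EFin.
have [sH|_] := boolP (s \in _); last by rewrite !mul0r mulr0.
have [_ invs] := histories_inv d_gt0 sH.
by rewrite (ran_active_card invs) size_histories// natrM mulf_div mulr1.
Qed.

Lemma probability_history_mem n (l : seq (seq {fset nat})) :
  uniq l -> {subset l <= histories d n} ->
  P [set w | history w n \in l] = ((size l)%:R / (size (histories d n))%:R)%:E.
Proof.
elim: l => [|s l IH] /=.
  move=> _ _; rewrite (_ : [set _ | _] = set0) ?measure0 ?mul0r//.
  by apply/seteqP; split.
move=> /andP[sl ul] sub.
rewrite (_ : [set _ | _] =
    [set w | history w n = s] `|` [set w | history w n \in l]); last first.
  apply/seteqP; split => w /=; rewrite inE.
    by move=> /predU1P.
  by move=> /predU1P.
rewrite measureU.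
- have sub' : {subset l <= histories d n}.
    by move=> t tl; apply: sub; rewrite inE tl orbT.
  apply: (etrans (congr2 (fun x y => x + y)%E (probability_history n s) (IH ul sub'))).
  by rewrite sub ?inE ?eqxx// -EFinD -mulrDl -natr1 addrC.
- exact: measurable_history.
- exact: (@measurable_history_pred n [set t | t \in l]).
- apply/seteqP; split => // w /= [->]; by rewrite (negbTE sl).
Qed.

(** Nothing is assumed on sequences outside [histories d n], so the complement is estimated: the
    event avoids every listed history failing [b], and the probability of those is known exactly. *)
Lemma probability_history_le n (Q : set (seq {fset nat})) (b : pred (seq {fset nat})) :
  (forall s, s \in histories d n -> Q s -> b s) ->
  (P [set w | Q (history w n)] <=
   ((count b (histories d n))%:R / (size (histories d n))%:R)%:E)%E.
Proof.
move=> Qb; pose l := [seq s <- histories d n | ~~ b s].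
have ml : measurable [set w | history w n \in l].
  exact: (@measurable_history_pred n [set t | t \in l]).
apply: (@le_trans _ _ (P (~` [set w | history w n \in l]))).
  apply: le_measure; rewrite ?inE.
  - exact: measurable_history_pred.
  - exact: measurableC.
  move=> w /= Qw; rewrite mem_filter => /andP[nb wH].
  by rewrite (Qb _ wH Qw) in nb.
rewrite probability_setC// probability_history_mem ?filter_uniq ?histories_uniq//; last first.
  by move=> s; rewrite mem_filter => /andP[].
rewrite size_filter -EFinB lee_fin.
have H0 : (size (histories d n))%:R != 0 :> R.
  by rewrite pnatr_eq0 -lt0n size_histories_gt0.
by rewrite -[X in X - _](divff H0) -mulrBl -(count_predC b) natrD addrK.
Qed.

End history_law.

(** * Concentration of the degree proportions *)

Section deviation.
Variables (R : realType) (d : nat).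
Hypothesis d_ge2 : (2 <= d)%N.
Local Notation D := (d%:R : R).

Lemma cvg_ln_nat : ln n%:R @[n --> \oo] --> (+oo : set_system R).
Proof.
apply/cvgryPge => A; near=> n; rewrite -[A]expRK ler_ln ?posrE ?expR_gt0//.
  by near: n; exact: nbhs_infty_ger.
by rewrite ltr0n; near: n; exact: nbhs_infty_gt.
Unshelve. all: end_near. Qed.

Lemma degree_proportion_concentration (disp : measure_display)
    (T : measurableType disp) (P : probability T R) (C : nat -> T -> {fset nat}) :
  ran_process P d C ->
  P [set w | ((1 * Num.sqrt (ln n%:R / n%:R))%:E <=
               ereal_sup [set (`|degree_proportion R d n (ran d (C ^~ w) n) k
                                 - limit_degree_proportion R d k|)%:E
                         | k in [set: nat]])%E]
    @[n --> \oo] --> 0%E.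
Proof.
move=> procC; have d_gt0 : (0 < d)%N by exact: ltnW.
have D2 : 2 <= D by rewrite ler_nat.
pose M := noise_bound R d.
have M0 : 0 <= M by exact: sqr_ge0.
apply: (@squeeze_cvge _ _ _ _ (fun=> 0%E) _ (fun n => (4 * (9 + M) * (ln n%:R)^-1)%:E)).
- near=> n; rewrite measure_ge0 /=.
  have n1 : (1 <= n)%N by near: n; exact: nbhs_infty_ge.
  (* This threshold makes [sqrt (n * ln n)] exceed [2 * (2 * D + 14)], so that the deterministic
     error is below half of the allowed deviation. *)
  have ln1 : (2 * (2 * D + 14)) ^+ 2 + 1 <= ln n%:R :> R.
    by near: n; move/cvgryPge: cvg_ln_nat; apply.
  have n1R : 1 <= n%:R :> R by rewrite ler1n.
  have K0 : 0 <= (2 * (2 * D + 14)) ^+ 2 by exact: sqr_ge0.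
  have ln0 : 0 < ln n%:R :> R by lra.
  (* The square root of [t] is half of [sqrt (n * ln n)], the allowed deviation multiplied by [n].
     Markov's inequality at level [t] costs [O(1 / ln n)]. *)
  pose t : R := n%:R * ln n%:R / 4.
  have t0 : 0 < t by apply: divr_gt0 => //; apply: mulr_gt0; lra.
  pose Q (s : seq {fset nat}) :=
    ((1 * Num.sqrt (ln n%:R / n%:R))%:E <=
       ereal_sup [set (`|degree_proportion R d n (history_network d s) k
                         - limit_degree_proportion R d k|)%:E
                 | k in [set: nat]])%E.
  rewrite (_ : [set _ | _] = [set w | Q (history C w n)]); last first.
    by apply/seteqP; split => w /=; rewrite ran_history.
  pose b s := t <= square_deviation R d n n.+2 (history_network d s).
  apply: (@le_trans _ _ ((count b (histories d n))%:R
      / (size (histories d n))%:R)%:E).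
    apply: (@probability_history_le _ _ d_gt0 _ _ _ _ procC n Q b).
    move=> s /(histories_inv d_gt0)[_ invs] Qs.
    (* By contraposition: a square deviation below [t] puts the supremum strictly below [r / n], the
       threshold of the event. *)
    rewrite /b leNgt; apply/negP => St.
    pose r : R := Num.sqrt (n%:R * ln n%:R).
    have r0 : 0 < r by rewrite sqrtr_gt0 mulr_gt0//; lra.
    have rK : 2 * (2 * D + 14) < r.
      have a0 : 0 <= 2 * (2 * D + 14) by lra.
      rewrite -ltr_sqr ?nnegrE ?(ltW r0)//.
      rewrite sqr_sqrtr; last by rewrite mulr_ge0// ltW.
      nra.
    have sup_le : (ereal_sup [set (`|degree_proportion R d n (history_network d s) k
                         - limit_degree_proportion R d k|)%:E
                 | k in [set: nat]] <= ((r / 2 + 2 * D + 14) / n%:R)%:E)%E.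
      apply: ge_ereal_sup => _ [k _ <-]; rewrite lee_fin.
      rewrite ler_pdivlMr; last lra.
      have := degree_proportion_deviation R d_ge2 k invs.
      have St' : Num.sqrt (square_deviation R d n n.+2 (history_network d s)) <= r / 2.
        rewrite -[r / 2]ger0_norm; last lra.
        rewrite -sqrtr_sqr ler_sqrt ?sqr_ge0// expr_div_n sqr_sqrtr.
          by apply: le_trans (ltW St) _; rewrite /t expr2; lra.
        by rewrite mulr_ge0// ltW.
      set e := `|_| => ek.
      have : e * n%:R <= e * (ran_order d n)%:R.
        by rewrite ler_wpM2l ?normr_ge0// ler_nat /ran_order -addnA leq_addr.
      lra.
    have := le_trans Qs sup_le; rewrite lee_fin mul1r.
    have -> : Num.sqrt (ln n%:R / n%:R) = r / n%:R :> R.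
      have -> : ln n%:R / n%:R = (n%:R * ln n%:R) / n%:R ^+ 2 :> R by field; lra.
      by rewrite sqrtrM ?sqrtrV ?sqrtr_sqr ?ger0_norm// ?mulr_ge0 ?sqr_ge0// ltW.
    rewrite ler_pM2r ?invr_gt0; lra.
  rewrite lee_fin; apply: le_trans (markov_histories d_ge2 n n.+2 t0) _.
  rewrite ler_pdivrMr// /t -/M.
  have -> : 4 * (9 + M) / ln n%:R * (n%:R * ln n%:R / 4) = (9 + M) * n%:R.
    by field; lra.
  nra.
- exact: cvg_cst.
- apply/fine_cvgP; split; first by near=> n.
  rewrite -[X in _ --> X](mulr0 (4 * (9 + M))).
  apply: cvgM; first exact: cvg_cst.
  apply/gtr0_cvgV0; last exact: cvg_ln_nat.
  by move/cvgryPgt: cvg_ln_nat; apply.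
Unshelve. all: end_near. Qed.

End deviation.

(** * The limit distribution indexed by the degree *)

Section limit_distribution.
Variables (R : realType) (d : nat).
Hypothesis d_ge2 : (2 <= d)%N.
Local Notation D := (d%:R : R).
Local Notation p := (limit_degree_proportion R d).

Let p_shift l : p (l + d.+1) = limit_proportion R d l.
Proof. by rewrite /limit_degree_proportion leqNgt addnS ltnS leq_addl/= -addnS addnK. Qed.

Lemma limit_degree_proportion_distribution :
  probability_distribution_from d.+1 p.
Proof.
split.
- move=> k; rewrite /limit_degree_proportion; case: ifP => // _.
  exact/ltW/limit_proportion_gt0.
- by move=> k; rewrite ltnS /limit_degree_proportion => ->.
(* The partial sum over [k < n + d + 2] contains exactly the [n + 1] terms of levels 0 to [n]. *)
apply/cvg_lim => //; rewrite -(cvg_shiftn (d.+2)).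
rewrite (_ : [sequence _]_n = EFin \o (fun n => \sum_(l < n.+1) limit_proportion R d l)).
  by apply: cvg_EFin; [exact: nearW|exact: cvg_sum_limit_proportion].
apply/funext => n /=; rewrite sumEFin; congr EFin.
rewrite -addSnnS (big_cat_nat (n := d.+1)) ?leq_addl//= big_nat_cond big1 ?add0r.
  rewrite -{1}[d.+1]add0n big_addn addnK big_mkord.
  by apply: eq_bigr => l _; exact: p_shift.
by move=> k; rewrite andbT /limit_degree_proportion /= ltnS => ->.
Qed.

Lemma limit_degree_proportion_Gamma k : (d < k)%N ->
  p k = D / (2 * D + 1)
        * (Gamma (k%:R - D + 2 / (D - 1)) / Gamma (1 + 2 / (D - 1)))
        * (Gamma (2 + (D + 2) / (D - 1))
           / Gamma (k%:R + 1 - D + (D + 2) / (D - 1))).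
Proof.
move=> dk; rewrite -(subnK dk) p_shift limit_proportion_Gamma//.
have E (l : nat) : (l + d.+1)%:R = l%:R + D + 1 by rewrite natrD -natr1 addrA.
have -> : (k - d.+1 + d.+1)%:R - D = (k - d.+1)%:R + 1 by rewrite E; lra.
have -> : (k - d.+1 + d.+1)%:R + 1 - D = (k - d.+1)%:R + 2 by rewrite E; lra.
by [].
Qed.

Lemma limit_degree_proportion_power_law :
  let tau := (2 * D - 1) / (D - 1) in
  exists2 K : R, 0 < K &
  exists2 eps : nat -> R, eps k @[k --> \oo] --> (0 : R) &
  forall k : nat, (d < k)%N -> p k = K * k%:R `^ (- tau) * (1 + eps k).
Proof.
move=> tau; have [K K0 cvgK] := limit_proportion_power_law R d_ge2.
have K_neq0 : K != 0 by rewrite gt_eqF.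
(* [eps] is the relative error itself, so the identity is algebra and the convergence is the
   content. *)
exists K => //; exists (fun k => p k * k%:R `^ tau / K - 1).
  rewrite -(cvg_shiftn d.+1) (_ : (fun _ => _) = (fun l =>
    limit_proportion R d l * (l + d.+1)%:R `^ tau / K - 1)); last first.
    by apply/funext => l; rewrite p_shift.
  suff : limit_proportion R d l * (l + d.+1)%:R `^ tau / K - 1 @[l --> \oo]
    --> K / K - 1 by rewrite divff ?subrr.
  by apply: cvgB; [apply: cvgM => //; exact: cvg_cst|exact: cvg_cst].
move=> k dk; rewrite subrKC powRN.
have k0 : k%:R `^ tau != 0.
  by rewrite gt_eqF// powR_gt0// ltr0n (leq_ltn_trans _ dk).
by field; rewrite k0 K_neq0.
Qed.

End limit_distribution.

Theorem theorem2p6 (R : realType) (d : nat) (hd : (2 <= d)%N) :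
  let D : R := d%:R in
  let tau : R := (2 * D - 1) / (D - 1) in
  exists (p : nat -> R) (c : R),
  [/\ probability_distribution_from d.+1 p,
      (forall (disp : measure_display) (T : measurableType disp)
              (P : probability T R) (C : nat -> T -> {fset nat}),
         ran_process P d C ->
         P [set w | ((c * Num.sqrt (ln n%:R / n%:R))%:E <=
                     ereal_sup [set (`|degree_proportion R d n
                                         (ran d (C ^~ w) n) k - p k|)%:E
                                   | k in [set: nat]])%E]
           @[n --> \oo] --> 0%E),
      2 < tau <= 3,
      (forall k : nat, (d.+1 <= k)%N ->
         p k = D / (2 * D + 1)
               * (Gamma (k%:R - D + 2 / (D - 1)) / Gamma (1 + 2 / (D - 1)))
               * (Gamma (2 + (D + 2) / (D - 1))
                  / Gamma (k%:R + 1 - D + (D + 2) / (D - 1))))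
    & exists2 K : R, 0 < K &
      exists2 eps : nat -> R, eps k @[k --> \oo] --> (0 : R) &
      forall k : nat, (d.+1 <= k)%N ->
        p k = K * k%:R `^ (- tau) * (1 + eps k)].
Proof.
move=> D tau; have D2 : 2 <= D by rewrite ler_nat.
have D1 : 0 < D - 1 by lra.
exists (limit_degree_proportion R d), 1; split.
- exact: limit_degree_proportion_distribution.
- by move=> disp T P C; exact: degree_proportion_concentration.
- by rewrite ltr_pdivlMr// ler_pdivrMr//; lra.
- by move=> k; exact: limit_degree_proportion_Gamma.
- exact: limit_degree_proportion_power_law.
Qed.
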